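(* Let $A$ and $B$ be closed convex sets in $\mathbb{E}$ and $\bar x\in A\cap B$. (1) If the collection of sets $\{A,B\}$ is subtransversal at $\bar x$ with constant $\mathrm{sr}'[A,B](\bar x)<+\infty$, then for any number $c\in[0,1)$ with $c\in(1-\mathrm{sr}'[A,B](\bar x)^{-2},1)$, all alternating projections sequences starting sufficiently close to $\bar x$ are linearly monotone with respect to $A\cap B$ with rate not greater than $c$. (2) Conversely, if there exists a number $c\in[0,1)$ such that every alternating projections iteration starting sufficiently close to $\bar x$ converges R-linearly to some point in $A\cap B$ with rate not greater than $c$, then the collection of sets $\{A,B\}$ is subtransversal at $\bar x$ with constant $\mathrm{sr}'[A,B](\bar x)\le\frac1{1-c}$.
   Context: $\mathbb{E}$ is a Euclidean space; $\operatorname{dist}(x,C):=\inf_{a\in C}\|x-a\|$; $\mathbb{B}_\delta(x)$ is the open ball; $P_C$ is the (single-valued) projection onto the nonempty closed convex set $C$. Alternating projections sequence: $x_{k+1}=P_AP_Bx_k$ for all $k\in\mathbb{N}$, with starting point $x_0\in A$ (standing assumption). ''Starting sufficiently close to $\bar x$'' means: there is $\rho>0$ such that the property holds for all starting points $x_0\in A\cap\mathbb{B}_\rho(\bar x)$. Linear monotonicity with respect to $S$ with rate (constant) $c\in[0,1]$: $\operatorname{dist}(x_{k+1},S)\le c\operatorname{dist}(x_k,S)$ for all $k\in\mathbb{N}$. R-linear convergence to $\tilde x$ with rate $c\in[0,1)$: there is $\gamma>0$ (possibly depending on the sequence) with $\|x_k-\tilde x\|\le\gamma c^k$ for all $k\in\mathbb{N}$.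 Subtransversality: $\{A,B\}$ is subtransversal at $\bar x\in A\cap B$ if there are $\delta>0$, $\kappa\ge0$ with $\operatorname{dist}(x,A\cap B)\le\kappa\max\{\operatorname{dist}(x,A),\operatorname{dist}(x,B)\}$ for all $x\in\mathbb{B}_\delta(\bar x)$. $\mathrm{sr}'[A,B](\bar x)$ denotes the infimum of all $\kappa\ge0$ for which there is $\delta>0$ with $\operatorname{dist}(x,A\cap B)\le\kappa\operatorname{dist}(x,B)$ for all $x\in A\cap\mathbb{B}_\delta(\bar x)$; subtransversality at $\bar x$ is equivalent to $\mathrm{sr}'[A,B](\bar x)<+\infty$. Convention: $0^{-2}=+\infty$. *)

(* Defs.v *)
From HB Require Import structures.
From mathcomp Require Import all_boot all_order all_algebra.
From mathcomp Require Import all_classical all_reals all_analysis.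

Set Implicit Arguments.
Unset Strict Implicit.
Unset Printing Implicit Defensive.

Import Order.TTheory GRing.Theory Num.Theory.
Import numFieldNormedType.Exports.

Local Open Scope classical_set_scope.
Local Open Scope ring_scope.

(* [Vector] forces finite dimension; the last axiom makes the inner product
   positive definite, the norm being a norm, and ties it to the norm, hence to
   the topology, of [E]. *)
HB.mixin Record hasInnerProduct (R : realType) E & NormedModule R E := {
  inner : E -> E -> R ;
  innerC : forall x y, inner x y = inner y x ;
  innerDZl : forall (a : R) (x y z : E),
    inner (a *: x + y) z = a * inner x z + inner y z ;
  innerxx : forall x, inner x x = `|x| ^+ 2
}.

#[short(type="euclideanType")]
HB.structure Definition Euclidean (R : realType) :=
  {E of NormedModule R E & Vector R E & hasInnerProduct R E}.

Section defs.
Context {R : realType} {E : euclideanType R}.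
Implicit Types (A B C S : set E) (x y : E) (u : nat -> E) (c : R).

(* [inf] is the infimum of a real set, with value 0 on the empty set: [dist x C]
   is the distance only for nonempty [C]. *)
Definition dist x C : R := inf [set `|x - a| | a in C].

(* The default value [x] is never used when [C] is nonempty, closed, convex. *)
Definition proj C x : E := xget x [set y | C y /\ `|x - y| = dist x C].

Definition altproj A B u : Prop :=
  A (u 0%N) /\ forall k, u k.+1 = proj A (proj B (u k)).

Definition starting_close A B x (P : (nat -> E) -> Prop) : Prop :=
  exists2 rho : R, 0 < rho &
    forall u, altproj A B u -> (A `&` ball x rho) (u 0%N) -> P u.

Definition linear_monotone S c u : Prop :=
  0 <= c <= 1 /\ forall k, dist (u k.+1) S <= c * dist (u k) S.

Definition Rlinear_cvg u x c : Prop :=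
  0 <= c < 1 /\
  exists2 gamma : R, 0 < gamma & forall k, `|u k - x| <= gamma * c ^+ k.

Definition subtransversal A B x : Prop :=
  exists delta kappa : R, [/\ 0 < delta, 0 <= kappa &
    forall y, ball x delta y ->
      dist y (A `&` B) <= kappa * Num.max (dist y A) (dist y B)].

(* sr'[A,B](x); the infimum of the empty set is [+oo]. *)
Definition sr' A B x : \bar R :=
  ereal_inf [set kappa%:E | kappa in [set kappa : R | 0 <= kappa /\
    exists2 delta : R, 0 < delta &
      forall y, (A `&` ball x delta) y ->
        dist y (A `&` B) <= kappa * dist y B]].

End defs.

(* Main.v *)
Require Import Defs.
From HB Require Import structures.
From mathcomp Require Import all_boot all_order all_algebra.
From mathcomp Require Import all_classical all_reals all_analysis.
From mathcomp Require Import ring lra.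

Import Order.TTheory GRing.Theory Num.Theory.
Import numFieldNormedType.Exports.

Local Open Scope classical_set_scope.
Local Open Scope ring_scope.

(** Write S for the intersection of A and B.

    Direct part.  The bound on c says exactly that sr'[A,B] is smaller than
    (1 - c)^(-1/2), so some constant k of subtransversality satisfies
    (1 - c) k^2 <= 1, that is, (1 - c) dist(x, S)^2 <= dist(x, B)^2 for x in A
    near xbar.  Let b be the projection of x onto B and a that of b onto A.
    Pythagoras' inequality at b gives dist(b, S)^2 <= c dist(x, S)^2, and
    [altproj_step_contraction] gains a second factor c in
    dist(a, S)^2 <= c dist(b, S)^2, hence the rate c and not only its square
    root.  The first factor comes from the error bound at x, the second from the
    error bound at a, which is still near xbar since projections onto A and B do
    not move away from the points of S.  The geometric heart is
    [obtuse_contraction], where the distance from a to B is bounded by the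
    distance from a to the segment joining b to the projection of a onto S.

    Converse part.  For successive projections u, v, w, t one has
    |v - w|^2 <= |u - v| |w - t| ([nearest_gap_log_convex]): gap lengths are
    log-convex, so their successive ratios never decrease.  R-linear convergence
    with rate c forces the gaps dist(x_k, B) to be O(c^k), so none of these
    ratios exceeds c: an asymptotic rate, with a constant depending on the
    sequence, has become a bound dist(x_(k+1), B) <= c dist(x_k, B) valid from
    the first step.  As |x_k - x_(k+1)| <= dist(x_k, B), summing a geometric
    series bounds the distance from x_0 to the limit by dist(x_0, B) / (1 - c)
    ([altproj_Rlinear_error_bound]); every x_0 in A near xbar starts such a
    sequence. *)

Section alternating_projections.
Context {R : realType} {E : euclideanType R}.
Implicit Types (x y z a b w : E) (A B C S : set E).

Import VectorInternalTheory.
Set Implicit Arguments.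
Unset Strict Implicit.

Local Notation proj := Defs.proj.
Local Notation convex C := (convex_set (C : set (convex_lmodType E))).

(** * Obtuse angles in an inner product space *)

Lemma inner0l z : inner 0 z = 0 :> R.
Proof. by have := innerDZl (1 : R) 0 0 z; rewrite scaler0 addr0; lra. Qed.

Lemma innerDl x y z : inner (x + y) z = inner x z + inner y z :> R.
Proof. by rewrite -[x]scale1r innerDZl mul1r scale1r. Qed.

Lemma innerZl t x z : inner (t *: x) z = t * inner x z :> R.
Proof. by rewrite -[t *: x]addr0 innerDZl inner0l addr0. Qed.

Lemma innerNl x z : inner (- x) z = - inner x z :> R.
Proof. by rewrite -scaleN1r innerZl mulN1r. Qed.

Lemma innerDr x y z : inner z (x + y) = inner z x + inner z y :> R.
Proof. by rewrite !(innerC z) innerDl. Qed.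

Lemma innerZr t x z : inner z (t *: x) = t * inner z x :> R.
Proof. by rewrite !(innerC z) innerZl. Qed.

Lemma innerNr x z : inner z (- x) = - inner z x :> R.
Proof. by rewrite !(innerC z) innerNl. Qed.

Definition innerE := (innerDl, innerDr, innerNl, innerNr, innerZl, innerZr).

Lemma inner_ge0 x : 0 <= inner x x :> R.
Proof. by rewrite innerxx sqr_ge0. Qed.

(** Cauchy-Schwarz: since the norm is already known to satisfy the triangle
    inequality, squaring the latter suffices. *)
Lemma inner_le_norm x y : inner x y <= `|x| * `|y| :> R.
Proof.
have : `|x + y| ^+ 2 <= (`|x| + `|y|) ^+ 2.
  by rewrite ler_sqr ?nnegrE ?addr_ge0//; exact: ler_normD.
by rewrite -innerxx !innerE !innerxx (innerC y x); nra.
Qed.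

Lemma pythagoras_le x y z : inner (x - y) (z - y) <= 0 :> R ->
  `|x - y| ^+ 2 + `|y - z| ^+ 2 <= `|x - z| ^+ 2.
Proof.
rewrite -!innerxx !innerE (innerC y x) (innerC z x) (innerC z y); lra.
Qed.

(** First-order optimality at the endpoint t = 0 of a quadratic on [0, 1]. *)
Lemma quadratic_slope_le0 (k n : R) : 0 <= n ->
  (forall t, 0 <= t <= 1 -> 2 * t * k <= t ^+ 2 * n) -> k <= 0.
Proof.
move=> n0 h; rewrite leNgt; apply/negP => k0.
(* t = k / (k + n) is in [0, 1] and small enough for t * n < k. *)
have kn : 0 < k + n by lra.
have t01 : 0 <= k / (k + n) <= 1.
  by rewrite ler_pdivrMr// mul1r divr_ge0; lra.
have := h _ t01; set t := k / (k + n) => ht.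
have t0 : 0 < t by rewrite divr_gt0.
have tE : t * (k + n) = k by rewrite mulfVK// gt_eqF.
have : 2 * k <= t * n by rewrite -(ler_pM2l t0); move: ht; lra.
have : 0 < t * k by rewrite mulr_gt0.
lra.
Qed.

Lemma convex_segment C x y (t : R) : convex C ->
  C x -> C y -> 0 <= t <= 1 -> C (t *: x + (1 - t) *: y).
Proof.
move=> cC Cx Cy /andP[t0 t1].
by have := cC x y (Itv01 t0 t1); rewrite !inE; exact.
Qed.

(** Moving from the nearest point y towards z inside C cannot reduce the
    distance to x, so the derivative of that distance at y is nonnegative. *)
Lemma nearest_obtuse C x y z : convex C ->
  C y -> (forall w, C w -> `|x - y| <= `|x - w|) -> C z ->
  inner (x - y) (z - y) <= 0 :> R.
Proof.
move=> cC Cy ymin Cz.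
apply: (@quadratic_slope_le0 _ (inner (z - y) (z - y))); first exact: inner_ge0.
move=> t t01; have Cw := convex_segment cC Cz Cy t01.
have : `|x - y| ^+ 2 <= `|x - (t *: z + (1 - t) *: y)| ^+ 2.
  by rewrite ler_sqr ?nnegrE// ymin.
have -> : x - (t *: z + (1 - t) *: y) = (x - y) - t *: (z - y).
  rewrite scalerBl scale1r scalerBr !opprD !opprK -!addrA.
  by congr (_ + _); rewrite addrCA.
move: (x - y) (z - y) => p q.
by rewrite -!innerxx !innerE (innerC q p); lra.
Qed.

(** With P, Q, k standing for |a|^2, |b|^2 and the inner product of a and b, the
    hypothesis bounds from below the squared distance from a to each point t b
    of the segment [0, b]; the condition on k puts the orthogonal projection of
    a onto the line through b, namely t = k / Q, inside this segment. *)
Lemma sqr_le_of_segment (r P Q k : R) : 0 <= k <= Q ->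
  (forall t, 0 <= t <= 1 -> (1 - r) * P <= P - 2 * t * k + t ^+ 2 * Q) ->
  k ^+ 2 <= r * P * Q.
Proof.
move=> /andP[k0 kQ] h.
have [Q0|Q0] := leP Q 0.
  have -> : Q = 0 by lra.
  have -> : k = 0 by lra.
  by rewrite expr0n/= mulr0.
have t01 : 0 <= k / Q <= 1 by rewrite ler_pdivrMr// mul1r kQ divr_ge0// ltW.
have := h _ t01; set t := k / Q.
have tQ : t * Q = k by rewrite mulfVK// gt_eqF.
have t0 : 0 <= t by case/andP: t01.
move=> ht.
have e : t ^+ 2 * Q = t * k by rewrite expr2 -mulrA tQ.
have e2 : k ^+ 2 = t * k * Q by rewrite -tQ; ring.
rewrite e2 ler_wpM2r ?(ltW Q0)//.
move: ht; rewrite e; lra.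
Qed.

(** With P = |a|^2, Q = |b|^2, k and m the inner products of b with a and z:
    - the angles at a, and at the origin between a and z, give P + m <= k;
    - the distance from a to the segment [0, b] gives k^2 <= r P Q;
    - |b - z|^2 = Q - 2 m + |z|^2, so Q <= |b - z|^2 + 2 m.
    Hence (P + m)^2 <= r P (|b - z|^2 + 2 m); as m >= 0 and r <= 1 the terms
    in m on the right are absorbed by those on the left, which leaves
    P <= r |b - z|^2. *)
Lemma obtuse_contraction_at_origin a b z (r : R) : 0 <= r <= 1 ->
  inner (b - a) (z - a) <= 0 :> R -> inner (b - a) a >= 0 :> R ->
  inner a z <= 0 :> R -> inner (b - z) z >= 0 :> R ->
  (forall t, 0 <= t <= 1 -> (1 - r) * `|a| ^+ 2 <= `|a - t *: b| ^+ 2) ->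
  `|a| ^+ 2 <= r * `|b - z| ^+ 2.
Proof.
move=> /andP[r0 r1] haz ha0 hz hb hseg.
have P0 := inner_ge0 a; have T0 := inner_ge0 z; have Q0 := inner_ge0 b.
have D0 := inner_ge0 (b - z); have BA := inner_ge0 (b - a).
have K : inner a b ^+ 2 <= r * inner a a * inner b b :> R.
  apply: sqr_le_of_segment => [|t /hseg].
    move: haz ha0 hz hb BA; rewrite !innerE.
    by rewrite ?(innerC b a) ?(innerC z b) ?(innerC z a); lra.
  by rewrite -!innerxx !innerE (innerC b a); lra.
rewrite -!innerxx.
move: haz ha0 hz hb D0 BA.
rewrite !innerE ?(innerC b a) ?(innerC z b) ?(innerC z a).
move: K P0 T0 Q0.
move: (inner a b : R) (inner a a : R) (inner b b : R).
move: (inner z z : R) (inner b z : R) (inner a z : R).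
move=> T m l k P Q K P0 T0 Q0 haz ha0 hz hb D0 BA.
have m0 : 0 <= m by lra.
have kPm : (P + m) ^+ 2 <= k ^+ 2 by rewrite ler_sqr ?nnegrE; lra.
rewrite leNgt; apply/negP => lt.
have {}D0 : 0 <= Q - 2 * m + T by lra.
have {}lt : r * (Q - 2 * m + T) < P by lra.
have Pgt0 : 0 < P by apply: le_lt_trans lt; exact: mulr_ge0.
have h1 : P * (r * (Q - 2 * m + T)) < P * P by rewrite ltr_pM2l.
have h2 : 0 <= r * P * T by rewrite !mulr_ge0.
have h3 : 0 <= (1 - r) * (P * m) by rewrite !mulr_ge0//; lra.
have h4 := sqr_ge0 m.
lra.
Qed.

(** * Nearest points of closed convex sets *)

Lemma r2v_continuous : continuous (r2v : 'rV[R]_(dim E) -> E).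
Proof.
have -> : (r2v : 'rV[R]_(dim E) -> E) =
    fun v => \sum_(j < dim E) v ord0 j *: (r2v (delta_mx ord0 j) : E).
  apply/funext => v; rewrite {1}[v]row_sum_delta linear_sum /=.
  by apply: eq_bigr => j _; rewrite linearZ.
apply: continuous_big => [|j _ v]; first exact: add_continuous.
apply: (@cvgZl _ _ _ (nbhs v)); exact: coord_continuous.
Qed.

(** Comparison of the norm of E with the sup norm of coordinates: by homogeneity
    it suffices to minimize on the unit sphere, which is compact. *)
Lemma r2v_coercive :
  exists2 m : R, 0 < m & forall v : 'rV[R]_(dim E), m * `|v| <= `|r2v v : E|.
Proof.
pose sphere := [set v : 'rV[R]_(dim E) | `|v| = 1].
have normr2v v : r2v v = 0 :> E -> v = 0.
  by move=> v0; apply: (@r2v_inj _ E); rewrite v0 linear0.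
have homog (m : R) : (forall v, sphere v -> m <= `|r2v v : E|) ->
    forall v : 'rV[R]_(dim E), m * `|v| <= `|r2v v : E|.
  move=> hm v; have [->|v0] := eqVneq v 0.
    by rewrite linear0 !normr0 mulr0.
  have nv : 0 < `|v| by rewrite normr_gt0.
  have /hm : sphere (`|v|^-1 *: v).
    by rewrite /sphere/= normrZ ger0_norm ?invr_ge0// mulVf// gt_eqF.
  rewrite linearZ/= normrZ ger0_norm ?invr_ge0//.
  by rewrite mulrC ler_pdivlMr.
(* The sphere is empty when E has dimension 0. *)
have [s0|/set0P s0] := eqVneq sphere set0.
  by exists 1 => //; apply: homog => v; rewrite s0.
have cS : compact sphere.
  apply: bounded_closed_compact.
    by exists 1; split => // M M1 v /= ->; exact: ltW.
  apply: (@preimage_closed _ _ (fun v : 'rV[R]_(dim E) => `|v|) [set 1]).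
    by move=> v _; exact: norm_continuous.
  exact: closed_eq.
have [|v vS vmin] :=
    compact_EVT_min (f := fun v : 'rV[R]_(dim E) => `|r2v v : E|) s0 cS.
  apply: continuous_subspaceT => v.
  exact: (continuous_comp (@r2v_continuous v) (@norm_continuous _ _ _)).
exists `|r2v v : E|; last by apply: homog => w Sw; apply: vmin; rewrite inE.
rewrite normr_gt0; apply/eqP => /normr2v v0.
by move: vS; rewrite inE /sphere/= v0 normr0 => /esym/eqP; rewrite oner_eq0.
Qed.

(** In coordinates, the points of C that are no farther from x than a given
    point c of C form a closed bounded, hence compact, set. *)
Lemma nearest_exists C x : closed C -> C !=set0 ->
  exists2 y, C y & forall z, C z -> `|x - y| <= `|x - z|.
Proof.
move=> clC [c Cc].
have [m m0 hm] := r2v_coercive.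
pose D := [set v : 'rV[R]_(dim E) | C (r2v v) /\ `|x - r2v v| <= `|x - c|].
have cf : continuous (fun v : 'rV[R]_(dim E) => `|x - r2v v : E|).
  move=> v; apply: (@cvg_norm _ _ _ (nbhs v)).
  by apply: (@cvgB _ _ _ (nbhs v)); [exact: cvg_cst|exact: r2v_continuous].
have D0 : D !=set0 by exists (v2r c); rewrite /D/= v2rK.
have cD : compact D.
  apply: bounded_closed_compact.
    exists ((`|x| + `|x - c|) / m); split; first exact: num_real.
    move=> M /ltW KM v [_ vc] /=; apply: le_trans KM.
    rewrite ler_pdivlMr// mulrC (le_trans (hm v))//.
    have -> : r2v v = x - (x - r2v v) :> E by rewrite opprB addrC subrK.
    by rewrite (le_trans (ler_normB _ _))// lerD2l.
  apply: closedI.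
    apply: (@preimage_closed _ _ (r2v : _ -> E)) => // v _.
    exact: r2v_continuous.
  apply: (@preimage_closed _ _ (fun v : 'rV[R]_(dim E) => `|x - r2v v : E|)
    [set r | r <= `|x - c|]).
    by move=> v _; exact: cf.
  exact: closed_le.
have [|v + vmin] :=
    compact_EVT_min (f := fun v : 'rV[R]_(dim E) => `|x - r2v v : E|) D0 cD.
  exact: continuous_subspaceT.
rewrite inE => -[Cv vc]; exists (r2v v) => // z Cz.
have [zc|/ltW zc] := leP `|x - z| `|x - c|; last exact: le_trans vc _.
by have := vmin (v2r z); rewrite v2rK; apply; rewrite inE /D/= v2rK.
Qed.

Lemma dist_le C x a : C a -> dist x C <= `|x - a|.
Proof.
move=> Ca; apply: ge_inf; last by exists a.
by exists 0 => _ [b _ <-].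
Qed.

Lemma dist_ge C x (r : R) : C !=set0 -> (forall a, C a -> r <= `|x - a|) ->
  r <= dist x C.
Proof.
move=> [c Cc] h; apply: lb_le_inf; first by exists `|x - c|, c.
by move=> _ [a Ca <-]; exact: h.
Qed.

Lemma dist_ge0 C x : C !=set0 -> 0 <= dist x C.
Proof. by move=> C0; apply: dist_ge. Qed.

Lemma projP C x : closed C -> C !=set0 ->
  C (proj C x) /\ `|x - proj C x| = dist x C.
Proof.
move=> clC C0; rewrite /proj; case: xgetP => [//|none].
have [y Cy ymin] := nearest_exists x clC C0.
case: (none y); split => //; apply/le_anti; rewrite dist_le// andbT.
exact: dist_ge.
Qed.

Lemma proj_obtuse C x z : closed C -> convex C ->
  C z -> inner (x - proj C x) (z - proj C x) <= 0 :> R.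
Proof.
move=> clC cC Cz; have C0 : C !=set0 by exists z.
have [Cp px] := projP x clC C0.
by apply: (nearest_obtuse cC) => // w Cw; rewrite px dist_le.
Qed.

(** The quantitative form of the nonexpansiveness of projections: the squared
    distance to a point of C drops by at least the squared length of the
    move. *)
Lemma proj_fejer C x z : closed C -> convex C ->
  C z -> `|x - proj C x| ^+ 2 + `|proj C x - z| ^+ 2 <= `|x - z| ^+ 2.
Proof. by move=> clC cC Cz; apply/pythagoras_le/proj_obtuse. Qed.

Lemma proj_nonexpansive C x z : closed C -> convex C ->
  C z -> `|proj C x - z| <= `|x - z|.
Proof.
move=> clC cC Cz; rewrite -ler_sqr ?nnegrE//.
by have := proj_fejer x clC cC Cz; have := sqr_ge0 `|x - proj C x|; lra.
Qed.

Lemma convex_setI C S : convex C -> convex S -> convex (C `&` S).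
Proof.
move=> cC cS x y t; rewrite !inE => -[Cx Sx] [Cy Sy].
by split; apply/set_mem; [apply: cC|apply: cS]; rewrite inE.
Qed.

(** * One step of alternating projections contracts the distance *)

(** Here b is to be projected onto a (in A), onto z (in S), and a onto w (in S);
    the right-hand side of the segment hypothesis is at least dist(a, B)^2,
    since the segment [w, b] lies in B.  The two projections onto S have
    different tasks: w realizes the distance to be bounded, and z the one that
    bounds it. *)
Lemma obtuse_contraction a b w z (r : R) : 0 <= r <= 1 ->
  inner (b - a) (z - a) <= 0 :> R -> inner (b - a) (w - a) <= 0 :> R ->
  inner (a - w) (z - w) <= 0 :> R -> inner (b - z) (w - z) <= 0 :> R ->
  (forall t, 0 <= t <= 1 ->
    (1 - r) * `|a - w| ^+ 2 <= `|a - (t *: b + (1 - t) *: w)| ^+ 2) ->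
  `|a - w| ^+ 2 <= r * `|b - z| ^+ 2.
Proof.
move=> r01 haz haw hz hb hseg.
have shift (p q : E) : (p - w) - (q - w) = p - q.
  by rewrite opprB addrA subrK.
rewrite -(shift b z); apply: obtuse_contraction_at_origin => //.
- by rewrite !shift.
- by rewrite shift -(opprB w a) innerNr oppr_ge0.
- by rewrite shift -(opprB w z) innerNr oppr_ge0.
move=> t /hseg; congr (_ <= `|_| ^+ 2).
rewrite scalerBl scale1r scalerBr !opprD !opprK -!addrA.
by congr (_ + _); rewrite addrCA.
Qed.

(** Each of the two projections gains a factor c on the squared distance to the
    intersection: the first by Pythagoras' inequality and the error bound at x,
    the second by the error bound at the new point. *)
Lemma altproj_step_contraction A B x (c : R) : closed A -> convex A ->
  closed B -> convex B -> A `&` B !=set0 -> 0 <= c <= 1 -> A x ->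
  let a := proj A (proj B x) in
  (1 - c) * dist x (A `&` B) ^+ 2 <= dist x B ^+ 2 ->
  (1 - c) * dist a (A `&` B) ^+ 2 <= dist a B ^+ 2 ->
  dist a (A `&` B) <= c * dist x (A `&` B).
Proof.
move=> clA cA clB cB S0 c01 Ax a hx ha.
have clS : closed (A `&` B) by exact: closedI.
have cS := convex_setI cA cB.
have A0 : A !=set0 by exists x.
have B0 : B !=set0 by case: S0 => s [_ Bs]; exists s.
have c0 : 0 <= c by case/andP: c01.
have [bB bE] := projP x clB B0; set b := proj B x in a hx ha bB bE *.
have [aA aE] := projP b clA A0; rewrite -/a in aA aE.
have [[xA xB] xE] := projP x clS S0.
have [[zA zB] zE] := projP b clS S0.
have [[wA wB] wE] := projP a clS S0.
have hb : dist b (A `&` B) ^+ 2 <= c * dist x (A `&` B) ^+ 2.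
  have : dist b (A `&` B) ^+ 2 <= `|b - proj (A `&` B) x| ^+ 2.
    by rewrite ler_sqr ?nnegrE ?dist_ge0// dist_le.
  have := proj_fejer x clB cB xB; rewrite -/b bE xE; lra.
have hab : dist a (A `&` B) ^+ 2 <= c * dist b (A `&` B) ^+ 2.
  rewrite -wE -zE; apply: obtuse_contraction => //.
  - exact: proj_obtuse.
  - exact: proj_obtuse.
  - exact: proj_obtuse.
  - exact: proj_obtuse.
  move=> t t01; rewrite wE; apply: le_trans ha _.
  by rewrite ler_sqr ?nnegrE ?dist_ge0// dist_le//; exact: convex_segment.
rewrite -ler_sqr ?nnegrE ?mulr_ge0 ?dist_ge0// exprMn.
apply: le_trans hab _; rewrite expr2 -mulrA.
exact: ler_wpM2l.
Qed.

Lemma altproj_in A B u : closed A -> A !=set0 -> altproj A B u ->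
  forall k, A (u k).
Proof.
move=> clA A0 [Au0 uS] [//|k]; rewrite uS.
by have [] := projP (proj B (u k)) clA A0.
Qed.

(** The iterates do not leave a ball centred at a common point, so that local
    hypotheses at such a point apply along the whole sequence. *)
Lemma altproj_fejer A B u z : closed A -> convex A -> closed B -> convex B ->
  A z -> B z -> altproj A B u -> forall k, `|u k - z| <= `|u 0%N - z|.
Proof.
move=> clA cA clB cB Az Bz [_ uS]; elim=> [//|k IH]; rewrite uS.
apply: le_trans IH; apply: le_trans (proj_nonexpansive _ clA cA Az) _.
exact: proj_nonexpansive.
Qed.

Lemma altproj_linear_monotone A B xbar (c delta : R) : closed A -> convex A ->
  closed B -> convex B -> A xbar -> B xbar -> 0 <= c <= 1 -> 0 < delta ->
  (forall y, A y -> ball xbar delta y ->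
    (1 - c) * dist y (A `&` B) ^+ 2 <= dist y B ^+ 2) ->
  starting_close A B xbar (linear_monotone (A `&` B) c).
Proof.
move=> clA cA clB cB Ax Bx c01 d0 h; exists delta => // u uAB [_ u0].
split=> // k.
have A0 : A !=set0 by exists xbar.
have uA := altproj_in clA A0 uAB.
have ub j : ball xbar delta (u j).
  move: u0; rewrite -ball_normE/= distrC => u0.
  rewrite distrC; apply: le_lt_trans u0.
  exact: (altproj_fejer clA cA clB cB Ax Bx uAB).
have uE := uAB.2 k.
rewrite uE; apply: altproj_step_contraction => //; rewrite -?uE; try exact: h.
by exists xbar.
Qed.

(** * Log-convexity of the gaps *)

Lemma le_of_geometric_gap (x y gamma c : R) : 0 <= c < 1 ->
  (forall k, y <= x + gamma * c ^+ k) -> y <= x.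
Proof.
move=> /andP[c0 c1] h.
have cvg : (x + gamma * c ^+ k) @[k --> \oo] --> x + gamma * 0.
  apply: cvgD; first exact: cvg_cst.
  by apply: cvgMr; apply: cvg_expr; rewrite ger0_norm.
rewrite -[x]addr0 -(mulr0 gamma).
apply: (cvgr_to_ge cvg); exact: nearW.
Qed.

(** The points u, v, w, t are consecutive alternating projections.  The angle at
    w gives |v - w|^2 <= inner (v - w) (v - u), the angle at v allows replacing
    the first v by t, and Cauchy-Schwarz concludes. *)
Lemma nearest_gap_log_convex u v w t :
  inner (u - v) (t - v) <= 0 :> R -> inner (v - w) (u - w) <= 0 :> R ->
  `|v - w| ^+ 2 <= `|u - v| * `|w - t|.
Proof.
move=> ht hu; rewrite (distrC u) (distrC w).
apply: (@le_trans _ _ (inner (v - u) (t - w))); last exact: inner_le_norm.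
rewrite -innerxx; move: ht hu.
rewrite !innerE ?(innerC v u) ?(innerC w u) ?(innerC w v).
by rewrite ?(innerC t u) ?(innerC t v) ?(innerC t w); lra.
Qed.

(** If the interleaved sequence g 0, h 0, g 1, h 1, ... is log-convex, so is its
    subsequence g. *)
Lemma log_convex_even_terms (g h : nat -> R) : (forall k, 0 <= g k) ->
  (forall k, h k ^+ 2 <= g k * g k.+1) ->
  (forall k, g k.+1 ^+ 2 <= h k * h k.+1) ->
  forall k, g k.+1 ^+ 2 <= g k * g k.+2.
Proof.
move=> g0 hh gg k; have [->|gk] := eqVneq (g k.+1) 0.
  by rewrite expr0n/= mulr_ge0.
(* g_(k+1)^4 <= h_k^2 h_(k+1)^2 <= g_k g_(k+1)^2 g_(k+2); divide. *)
have gp : 0 < g k.+1 ^+ 2 by rewrite exprn_gt0// lt_neqAle eq_sym gk g0.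
rewrite -(ler_pM2l gp) -expr2.
apply: (@le_trans _ _ ((h k * h k.+1) ^+ 2)).
  rewrite ler_sqr ?nnegrE// ?gg//; first exact: ltW.
  exact: le_trans (ltW gp) (gg k).
rewrite exprMn.
apply: le_trans (ler_pM (sqr_ge0 _) (sqr_ge0 _) (hh k) (hh k.+1)) _.
by rewrite le_eqVlt; apply/orP; left; apply/eqP; ring.
Qed.

(** The ratios of consecutive terms of a log-convex sequence do not decrease; if
    the first one, q, exceeded c, the sequence would grow at least like q^k,
    against the bound gamma c^k. *)
Lemma log_convex_ratio_le (g : nat -> R) (c gamma : R) : 0 <= c < 1 ->
  (forall k, 0 <= g k) -> (forall k, g k.+1 ^+ 2 <= g k * g k.+2) ->
  (forall k, g k <= gamma * c ^+ k) -> g 1%N <= c * g 0%N.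
Proof.
move=> /andP[c0 c1] g0 lc hg; rewrite leNgt; apply/negP => lt.
have g00 : 0 < g 0%N.
  rewrite lt_neqAle g0 andbT eq_sym; apply/eqP => e.
  have := lc 0%N; rewrite e mul0r => h; move: lt; rewrite e mulr0 => lt.
  by have := exprn_gt0 2 lt; lra.
pose q := g 1%N / g 0%N.
have qc : c < q by rewrite /q ltr_pdivlMr.
have q0 : 0 < q by exact: le_lt_trans qc.
have step k : 0 < g k /\ q * g k <= g k.+1.
  elim: k => [|k [gk IH]]; first by split; rewrite // /q mulfVK// gt_eqF.
  have gk1 : 0 < g k.+1 by apply: lt_le_trans IH; exact: mulr_gt0.
  split=> //; rewrite -(ler_pM2l gk); apply: le_trans (lc k).
  rewrite expr2 mulrA (mulrC (g k)); exact: ler_wpM2r (ltW gk1) _ _ IH.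
have grow k : q ^+ k * g 0%N <= g k.
  elim: k => [|k IH]; first by rewrite expr0 mul1r.
  apply: le_trans (step k).2; rewrite exprS -mulrA.
  by rewrite ler_wpM2l// ltW.
have ratio01 : 0 <= c / q < 1.
  by rewrite divr_ge0 ?(ltW q0)//= ltr_pdivrMr// mul1r.
suff : g 0%N <= 0 by rewrite leNgt g00.
apply: (@le_of_geometric_gap _ _ gamma (c / q)) => // k.
have qk : 0 < q ^+ k by rewrite exprn_gt0.
rewrite add0r expr_div_n mulrA ler_pdivlMr// mulrC.
exact: le_trans (grow k) (hg k).
Qed.

(** The gaps between x_k and its projection onto B interleave with those between
    that projection and x_(k+1). *)
Lemma altproj_gap_log_convex A B u : closed A -> convex A -> closed B ->
  convex B -> B !=set0 -> altproj A B u ->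
  forall k, dist (u k.+1) B ^+ 2 <= dist (u k) B * dist (u k.+2) B.
Proof.
move=> clA cA clB cB B0 uAB.
have A0 : A !=set0 by exists (u 0%N); case: uAB.
have uA := altproj_in clA A0 uAB.
have bP k := projP (u k) clB B0.
pose b k := proj B (u k).
have bB k : B (b k) by case: (bP k).
have bE k : `|u k - b k| = dist (u k) B by case: (bP k).
have uE k : u k.+1 = proj A (b k) by exact: uAB.2.
have obB k z : B z -> inner (u k - b k) (z - b k) <= 0 :> R.
  exact: proj_obtuse.
have obA k z : A z -> inner (b k - u k.+1) (z - u k.+1) <= 0 :> R.
  by rewrite uE; exact: proj_obtuse.
apply: (@log_convex_even_terms _ (fun k => `|b k - u k.+1|)) => k.
- exact: dist_ge0.
- rewrite -!bE; apply: nearest_gap_log_convex; [exact: obB|exact: obA].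
- rewrite -!bE; apply: nearest_gap_log_convex; [exact: obA|exact: obB].
Qed.

(** Projecting onto A brings the projection of x_k onto B no farther from x_k,
    which is itself in A. *)
Lemma altproj_step_le A B u : closed A -> convex A -> closed B -> B !=set0 ->
  altproj A B u -> forall k, `|u k - u k.+1| <= dist (u k) B.
Proof.
move=> clA cA clB B0 uAB k.
have A0 : A !=set0 by exists (u 0%N); case: uAB.
have uA := altproj_in clA A0 uAB.
have [_ <-] := projP (u k) clB B0.
by rewrite uAB.2 distrC (distrC (u k) (proj B _)) proj_nonexpansive.
Qed.

(** The constant of R-linear convergence, which depends on the sequence, does
    not appear in the conclusion: it is eliminated once by log-convexity, which
    turns the asymptotic rate into a bound on every ratio of gaps, and once by
    letting k tend to infinity in the comparison of the start with the limit. *)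
Lemma altproj_Rlinear_error_bound A B u xt (c : R) : closed A -> convex A ->
  closed B -> convex B -> altproj A B u -> (A `&` B) xt ->
  Rlinear_cvg u xt c ->
  (1 - c) * dist (u 0%N) (A `&` B) <= dist (u 0%N) B.
Proof.
move=> clA cA clB cB uAB Sxt [c01 [gamma gamma0 hu]].
have [Axt Bxt] := Sxt; have B0 : B !=set0 by exists xt.
have /andP[c0 c1] := c01.
have lc := altproj_gap_log_convex clA cA clB cB B0 uAB.
have gap0 k : 0 <= dist (u k) B by exact: dist_ge0.
have ratio k : dist (u k.+1) B <= c * dist (u k) B.
  apply: (@log_convex_ratio_le
    (fun j => dist (u (j + k)%N) B) c (gamma * c ^+ k)) => // j.
    exact: lc.
  by rewrite -mulrA -exprD addnC; apply: le_trans (hu _); exact: dist_le.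
have gapk k : dist (u k) B <= c ^+ k * dist (u 0%N) B.
  elim: k => [|k IH]; first by rewrite expr0 mul1r.
  by apply: le_trans (ratio k) _; rewrite exprS -mulrA ler_wpM2l.
(* Partial sums of the geometric series of the steps, multiplied by 1 - c. *)
have drift k : (1 - c) * `|u 0%N - u k| <= dist (u 0%N) B * (1 - c ^+ k).
  elim: k => [|k IH]; first by rewrite subrr normr0 expr0 subrr !mulr0.
  have tri : `|u 0%N - u k.+1| <= `|u 0%N - u k| + c ^+ k * dist (u 0%N) B.
    apply: le_trans (ler_distD (u k) _ _) _; rewrite lerD2l.
    exact: le_trans (altproj_step_le clA cA clB B0 uAB k) (gapk k).
  have : (1 - c) * `|u 0%N - u k.+1| <=
         (1 - c) * (`|u 0%N - u k| + c ^+ k * dist (u 0%N) B).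
    by rewrite ler_wpM2l//; lra.
  by rewrite exprS; lra.
apply: (@le_of_geometric_gap _ _ ((1 - c) * gamma) c c01) => k.
have : (1 - c) * dist (u 0%N) (A `&` B) <=
       (1 - c) * (`|u 0%N - u k| + gamma * c ^+ k).
  rewrite ler_wpM2l//; first lra.
  apply: le_trans (dist_le _ Sxt) _.
  by apply: le_trans (ler_distD (u k) _ _) _; rewrite lerD2l.
have : 0 <= dist (u 0%N) B * c ^+ k by rewrite mulr_ge0// exprn_ge0.
by have := drift k; lra.
Qed.

(** A point y near xbar is reduced to its projection onto A, which is at least
    as near to xbar, at the cost of dist(y, A) in each of the two distances. *)
Lemma subtransversal_of_error_bound A B xbar (rho K : R) :
  closed A -> convex A -> A xbar -> B xbar -> closed B -> 0 < rho -> 0 <= K ->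
  (forall y, A y -> ball xbar rho y -> dist y (A `&` B) <= K * dist y B) ->
  subtransversal A B xbar.
Proof.
move=> clA cA Ax Bx clB rho0 K0 h; exists rho, (1 + 2 * K); split=> //.
  lra.
move=> y yb.
have A0 : A !=set0 by exists xbar.
have B0 : B !=set0 by exists xbar.
have S0 : A `&` B !=set0 by exists xbar.
have distD C x z : C !=set0 -> closed C -> dist x C <= `|x - z| + dist z C.
  move=> C0 clC; have [Cp <-] := projP z clC C0.
  by apply: le_trans (dist_le _ Cp) _; exact: ler_distD.
have [pA pE] := projP y clA A0; set p := proj A y in pA pE.
have pb : ball xbar rho p.
  move: yb; rewrite -!ball_normE/= !(distrC xbar); apply: le_lt_trans.
  exact: proj_nonexpansive.
have hp := h p pA pb.
have h1 := distD _ y p S0 (closedI clA clB).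
have h2 : K * dist p B <= K * (`|p - y| + dist y B).
  by rewrite ler_wpM2l// distD.
rewrite pE in h1; rewrite distrC pE in h2.
set M := Num.max _ _.
have MA : dist y A <= M by rewrite le_max lexx.
have MB : dist y B <= M by rewrite le_max lexx orbT.
have : K * dist y A <= K * M by rewrite ler_wpM2l.
have : K * dist y B <= K * M by rewrite ler_wpM2l.
lra.
Qed.

Lemma altproj_iter A B x : A x ->
  altproj A B (fun k => iter k (fun y => proj A (proj B y)) x).
Proof. by move=> Ax; split. Qed.

(** * The modulus of subtransversality *)

Lemma sr'_ge0 A B x : (0 <= sr' A B x)%E.
Proof. by apply: le_ereal_inf_tmp => _ [k [k0 _] <-]; rewrite lee_fin. Qed.

(** The hypothesis on c in usable form; the convention on the inverse of 0 makes
    the case of a zero modulus harmless, the right-hand side being positive. *)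
Lemma sr'_lt_sqrt A B x (c : R) : c < 1 -> (sr' A B x < +oo)%E ->
  (1 - (sr' A B x ^+ 2)^-1 < c%:E)%E ->
  (sr' A B x < (Num.sqrt (1 - c)^-1)%:E)%E.
Proof.
move=> c1; have := sr'_ge0 A B x.
case: (sr' A B x) => [s | // | //]; rewrite lee_fin => s0 _.
have c1' : 0 < 1 - c by lra.
rewrite -EFin_expe inver lte_fin sqrf_eq0.
have [->|sN0] := eqVneq s 0; first by rewrite sqrtr_gt0 invr_gt0.
have s2 : 0 < s ^+ 2 by rewrite exprn_gt0// lt_neqAle eq_sym sN0.
rewrite -EFinB lte_fin => h.
rewrite -[s]ger0_norm// -sqrtr_sqr ltr_sqrt ?invr_gt0//.
rewrite -[s ^+ 2]invrK ltf_pV2 ?posrE ?invr_gt0//; lra.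
Qed.

Lemma sr'_witness A B x (K : R) : (sr' A B x < K%:E)%E ->
  exists k delta : R, [/\ 0 <= k < K, 0 < delta &
    forall y, A y -> ball x delta y -> dist y (A `&` B) <= k * dist y B].
Proof.
move=> /ereal_inf_lt[_ [k [k0 [delta d0 h]] <-]]; rewrite lte_fin => kK.
exists k, delta; split=> // [|y Ay yb]; first by rewrite k0.
exact: h.
Qed.

End alternating_projections.

(* (sr' A B xbar ^+ 2)^-1 is taken in the extended reals, where 0^-1 = +oo. *)
Theorem theorem5p4 (R : realType) (E : euclideanType R) (A B : set E) (xbar : E)
    (Aclosed : closed A) (Bclosed : closed B)
    (Aconvex : convex_set (A : set (convex_lmodType E)))
    (Bconvex : convex_set (B : set (convex_lmodType E)))
    (xbarAB : (A `&` B) xbar) :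
  (subtransversal A B xbar -> (sr' A B xbar < +oo)%E ->
   forall c : R, 0 <= c < 1 ->
     (1 - (sr' A B xbar ^+ 2)^-1 < c%:E)%E ->
     starting_close A B xbar (fun u =>
       exists2 c' : R, c' <= c & linear_monotone (A `&` B) c' u))
  /\
  (forall c : R, 0 <= c < 1 ->
     starting_close A B xbar (fun u =>
       exists2 xt : E, (A `&` B) xt &
         exists2 c' : R, c' <= c & Rlinear_cvg u xt c') ->
     subtransversal A B xbar /\ (sr' A B xbar <= ((1 - c)^-1)%:E)%E).
Proof.
have [Ax Bx] := xbarAB; split.
  move=> _ srfin c /andP[c0 c1] hc.
  have [k [delta [/andP[k0 kK] d0 h]]] := sr'_witness (sr'_lt_sqrt c1 srfin hc).
  have ck : (1 - c) * k ^+ 2 <= 1.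
    have c1' : 0 < 1 - c by lra.
    rewrite -ler_pdivlMl// mulr1 -[_^-1]sqr_sqrtr ?invr_ge0 ?(ltW c1')//.
    by rewrite ler_sqr ?nnegrE ?sqrtr_ge0// ltW.
  have [||rho rho0 hmon] :=
    altproj_linear_monotone Aclosed Aconvex Bclosed Bconvex Ax Bx (c := c) _ d0.
  - by rewrite c0 ltW.
  - move=> y Ay yb.
    have S0 : A `&` B !=set0 by exists xbar.
    have B0 : B !=set0 by exists xbar.
    have : dist y (A `&` B) ^+ 2 <= (k * dist y B) ^+ 2.
      by rewrite ler_sqr ?nnegrE ?mulr_ge0 ?dist_ge0// h.
    rewrite exprMn => hy.
    have : (1 - c) * dist y (A `&` B) ^+ 2 <=
           (1 - c) * (k ^+ 2 * dist y B ^+ 2).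
      by rewrite ler_wpM2l//; lra.
    move/le_trans; apply; rewrite mulrA.
    by rewrite -[leRHS]mul1r ler_wpM2r// sqr_ge0.
  by exists rho => // u uAB u0; exists c => //; exact: hmon.
move=> c /andP[c0 c1] [rho rho0 hcvg].
have c1' : 0 < 1 - c by lra.
have bound y : A y -> ball xbar rho y ->
    dist y (A `&` B) <= (1 - c)^-1 * dist y B.
  move=> Ay yb; have uAB := altproj_iter B Ay.
  have [|xt Sxt [c' c'c cv]] := hcvg _ uAB; first by split.
  have :=
    altproj_Rlinear_error_bound Aclosed Aconvex Bclosed Bconvex uAB Sxt cv.
  rewrite /= ler_pdivlMl//; apply: le_trans.
  by rewrite ler_wpM2r ?dist_ge0//; [exists xbar|lra].
have K0 : 0 <= (1 - c)^-1 by rewrite invr_ge0 ltW.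
split; first exact: subtransversal_of_error_bound bound.
apply: ge_ereal_inf; exists ((1 - c)^-1)%:E => //.
exists (1 - c)^-1 => //; split=> //; exists rho => // y [Ay yb].
exact: bound.
Qed.
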